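(* There exists a constant $C>0$ such that for all integers $h\ge1$, $$V_{2,h}\ \ge\ \frac7{20}-\frac{C}{\left(\sqrt[5]{256}\right)^h}.$$
   Context: Two-player Levine hat game with $h\ge1$ hats: players A and B receive independent uniformly random stacks $U,V\in\{0,1\}^h$ ($1$ = black, $0$ = white). Each player sees only the other player's stack. An $h$-strategy is a function $k:\{0,1\}^h\to\{1,\dots,h\}$. If A uses $k_1$ and B uses $k_2$, the players win if and only if $U^{(k_1(V))}=V^{(k_2(U))}=1$, where $u^{(k)}$ is the $k$-th entry of $u$. $V_{2,h}$ denotes the maximum over all pairs $(k_1,k_2)$ of $h$-strategies of the winning probability. *)

(* Defs.v *)
From mathcomp Require Import all_boot all_order all_algebra.
From mathcomp Require Import reals exp.

Set Implicit Arguments.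
Unset Strict Implicit.
Unset Printing Implicit Defensive.

Import Order.TTheory GRing.Theory Num.Theory.

Local Open Scope ring_scope.

                                                                           
                                                  
Definition stack (h : nat) := {ffun 'I_h -> bool}.

Definition strategy (h : nat) := {ffun stack h -> 'I_h}.

                                                                               
                                       
Definition wins (h : nat) (k1 k2 : strategy h) (u v : stack h) : bool :=
  u (k1 v) && v (k2 u).

                                                                            
Definition win_prob (R : realType) (h : nat) (k1 k2 : strategy h) : R :=
  #|[set w : stack h * stack h | wins k1 k2 w.1 w.2]|%:R
    / #|{: stack h * stack h}|%:R.

                                                                      
                                                                         
Definition V2 (R : realType) (h : nat) : R :=
  \big[Num.max/0]_(k : strategy h * strategy h) win_prob R k.1 k.2.

(* Main.v *)
Require Import Defs.
From mathcomp Require Import all_boot all_order all_algebra.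
From mathcomp Require Import reals exp.
From mathcomp Require Import zify ring lra.

(** The error term comes from a recursion that spends two hats to divide the
    distance to 7/20 by 16:
<<
      V_{n+3} >= 21/64 + V_{n+1}/16,      with fixed point 7/20.
>>
    Call the first three hats of a stack a triple, and call it constant when
    its three hats have the same colour.  On a triple that is not constant,
    read cyclically, black is followed by white at exactly one place; a player
    who sees this happen at the positions (1,2), (2,3) or (3,1) points at
    position 3, 2 or 1 respectively.  A player who sees a constant triple of colour [x]
    replaces it by a single hat of colour [x], which turns the stack of n+3
    hats into one of n+1 hats, and plays a given strategy for n+1 hats there;
    an answer pointing at the merged hat is read as pointing at the first hat.
    Among the 64 pairs of triples there are:

    - 36 pairs of non-constant triples; the cyclic rule wins on 15 of them,
      whatever the other hats are.

    - 12 pairs in which only B's triple is constant.  A's triple is not, so B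
      is told to point inside B's own triple and is right exactly when that
      triple is black.  A points either at a later hat or at the first hat of
      A's triple; since the first hat is black in half of the non-constant
      triples, A is right with probability 1/2.  This contributes
      6 * 1/2 = 3 wins, and so does the symmetric case.

    - 4 pairs of constant triples, where the merged stacks are uniformly
      distributed and the given strategies win with their own probability.

    In total this gives (15 + 3 + 3 + 4 V_{n+1}) / 64; the count is
    [nwins_ext] and the recursion is [V2_rec].  As V_1 and V_2 are at least 0,
    induction yields V_h >= 7/20 - (28/5) / 4^h ([V2_lower]).  This is stronger
    than required, because 256^(1/5) <= 1024^(1/5) = 4. *)

Set Implicit Arguments.
Unset Strict Implicit.
Unset Printing Implicit Defensive.

Import Order.TTheory GRing.Theory Num.Theory.

Local Open Scope ring_scope.

Definition scons n (b : bool) (w : stack n) : stack n.+1 :=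
  [ffun i => if unlift ord0 i is Some j then w j else b].

Lemma scons0 n b (w : stack n) : scons b w ord0 = b.
Proof. by rewrite ffunE unlift_none. Qed.

Lemma sconsS n b (w : stack n) j : scons b w (lift ord0 j) = w j.
Proof. by rewrite ffunE liftK. Qed.

Lemma sum_stackS n (F : stack n.+1 -> nat) :
  (\sum_u F u = \sum_(w : stack n) (F (scons true w) + F (scons false w)))%N.
Proof.
rewrite (reindex (fun p : bool * stack n => scons p.1 p.2)) /=; last first.
  exists (fun u : stack n.+1 => (u ord0, [ffun j => u (lift ord0 j)])).
    move=> [b w] _ /=; rewrite scons0; congr (_, _).
    by apply/ffunP => j; rewrite ffunE sconsS.
  move=> u _ /=; apply/ffunP => i; rewrite ffunE.
  by case: unliftP => [j ->|->] //; rewrite ffunE.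
by rewrite -(pair_bigA _ (fun b w => F (scons b w))) /= big_bool /= big_split.
Qed.

(** Reversing all colours pairs the stacks in which hat [i] is black with those
    in which it is white. *)
Lemma sum_hat n (i : 'I_n.+1) : (\sum_(u : stack n.+1) u i = 2 ^ n)%N.
Proof.
pose neg (u : stack n.+1) : stack n.+1 := [ffun j => ~~ u j].
have negK : involutive neg by move=> u; apply/ffunP => j; rewrite !ffunE negbK.
have compl : (\sum_(u : stack n.+1) u i = \sum_(u : stack n.+1) ~~ u i)%N.
  rewrite (reindex_inj (inv_inj negK)) /=.
  by apply: eq_bigr => u _; rewrite ffunE.
have : (\sum_(u : stack n.+1) (u i + ~~ u i) = 2 ^ n.+1)%N.
  rewrite (eq_bigr (fun=> 1%N)); last by move=> u _; case: (u i).
  by rewrite sum1_card card_ffun card_bool card_ord.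
rewrite big_split /= -compl addnn -mul2n expnS => /eqP.
by rewrite eqn_pmul2l // => /eqP.
Qed.

Definition triple n (x y z : bool) (w : stack n) : stack n.+3 :=
  scons x (scons y (scons z w)).

Definition hat0 n : 'I_n.+3 := ord0.
Definition hat1 n : 'I_n.+3 := lift ord0 ord0.
Definition hat2 n : 'I_n.+3 := lift ord0 (lift ord0 ord0).

(** The merged stack of n+1 hats consists of the first hat and of the hats after
    the triple; [unmerge] sends its positions to positions in the full stack. *)
Definition unmerge n (i : 'I_n.+1) : 'I_n.+3 :=
  if unlift ord0 i is Some j then lift ord0 (lift ord0 (lift ord0 j)) else ord0.

(** When none of the three tests succeeds, the triple is constant. *)
Definition ext n (k : strategy n.+1) : strategy n.+3 :=
  [ffun u : stack n.+3 =>
    let: (x, y, z) := (u (hat0 n), u (hat1 n), u (hat2 n)) in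
    if x && ~~ y then hat2 n
    else if y && ~~ z then hat1 n
    else if z && ~~ x then hat0 n
    else unmerge (k [ffun i => u (unmerge i)])].

Lemma triple_hats n x y z (w : stack n) :
  ((triple x y z w (hat0 n) = x) * (triple x y z w (hat1 n) = y)
   * (triple x y z w (hat2 n) = z))%type.
Proof. by rewrite /triple /hat0 /hat1 /hat2 !(scons0, sconsS). Qed.

Lemma triple_unmerge n x y z (w : stack n) i :
  triple x y z w (unmerge i) = scons x w i.
Proof.
rewrite /unmerge /triple; case: unliftP => [j ->|->]; first by rewrite !sconsS.
by rewrite !scons0.
Qed.

Lemma extE n (k : strategy n.+1) x y z (w : stack n) :
  ext k (triple x y z w) =
    if x && ~~ y then hat2 n
    else if y && ~~ z then hat1 n
    else if z && ~~ x then hat0 n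
    else unmerge (k (scons x w)).
Proof.
rewrite ffunE !triple_hats; do 3![case: ifP => // _].
by congr (unmerge (k _)); apply/ffunP => i; rewrite ffunE triple_unmerge.
Qed.

(** A double sum rather than a cardinal of pairs, so that the stacks of the two
    players can be split into triple and rest independently of each other. *)
Definition nwins h (k1 k2 : strategy h) : nat :=
  \sum_u \sum_v wins k1 k2 u v.

(** The 21 is 15 + 3 + 3: wins between two non-constant triples, and those of
    either kind of mixed pair, where a player who sees a constant triple is
    right in half of the cases. *)
Lemma nwins_ext n (k1 k2 : strategy n.+1) :
  nwins (ext k1) (ext k2) = (21 * (2 ^ n * 2 ^ n) + nwins k1 k2)%N.
Proof.
pose half (k : strategy n.+1) (w w' : stack n) : nat :=
  (scons true w (k (scons true w')) + scons false w (k (scons true w')))%N.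
(* Averaging over the merged hat makes the merged stack uniform, so that a
   player pointing into it is right half of the time. *)
have half_sum k : (\sum_w \sum_w' half k w w' = 2 ^ n * 2 ^ n)%N.
  rewrite exchange_big /= (eq_bigr (fun=> 2 ^ n)%N).
    by rewrite sum_nat_const card_ffun card_bool card_ord.
  by move=> w' _; rewrite -(sum_hat (k (scons true w'))) sum_stackS.
(* With the later hats [w], [w'] fixed, the 64 pairs of triples are summed.
   The factor 3: each colour of the first hat occurs in three of the six
   non-constant triples.  In [half] the triple seen is black, since a player
   pointing into a white one loses. *)
have -> : nwins (ext k1) (ext k2) =
    (\sum_w \sum_w' (15 + 3 * half k1 w w' + 3 * half k2 w' w
       + (wins k1 k2 (scons true w) (scons true w')
          + wins k1 k2 (scons true w) (scons false w')
          + (wins k1 k2 (scons false w) (scons true w')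
             + wins k1 k2 (scons false w) (scons false w')))))%N.
  rewrite /nwins !sum_stackS; apply: eq_bigr => w _.
  rewrite !sum_stackS -!big_split /=; apply: eq_bigr => w' _.
  rewrite -!/(triple _ _ _ _) /wins !extE /= !triple_hats !triple_unmerge /half.
  rewrite !(andbT, andbF) /=; lia.
(* The coefficients are kept abstract: otherwise [big_split] would take a
   multiplication by a numeral for an iterated sum. *)
have sum_affine (p q : nat) (a b c : stack n -> stack n -> nat) :
    (\sum_w \sum_w' (p + q * a w w' + q * b w w' + c w w') =
     p * (2 ^ n * 2 ^ n) + q * (\sum_w \sum_w' a w w')
     + q * (\sum_w \sum_w' b w w') + \sum_w \sum_w' c w w')%N.
  under eq_bigr => w _ do
    rewrite !big_split -!big_distrr sum_nat_const card_ffun card_bool card_ord.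
  rewrite !big_split -!big_distrr sum_nat_const card_ffun card_bool card_ord /=.
  lia.
rewrite sum_affine half_sum exchange_big half_sum /nwins sum_stackS.
under [in RHS]eq_bigr => w _ do rewrite !sum_stackS -big_split.
by rewrite /=; lia.
Qed.

Lemma win_probE (R : realType) h (k1 k2 : strategy h) :
  win_prob R k1 k2 = (nwins k1 k2)%:R / 4 ^+ h.
Proof.
rewrite /win_prob card_prod card_ffun card_bool card_ord -expnMn natrX.
congr (_%:R / _).
rewrite /nwins (pair_bigA _ (fun u v => wins k1 k2 u v : nat)) /=.
rewrite -sum1_card big_mkcond /=; apply: eq_bigr => w _.
by rewrite inE; case: wins.
Qed.

Lemma win_prob_le_V2 (R : realType) h (k1 k2 : strategy h) :
  win_prob R k1 k2 <= V2 R h.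
Proof.
exact: (le_bigmax_cond _ (fun k => win_prob R k.1 k.2) (j := (k1, k2))).
Qed.

Lemma V2_rec (R : realType) n : 21 / 64 + V2 R n.+1 / 16 <= V2 R n.+3.
Proof.
have ext_le (k1 k2 : strategy n.+1) :
    21 / 64 + win_prob R k1 k2 / 16 <= V2 R n.+3.
  apply: le_trans (win_prob_le_V2 R (ext k1) (ext k2)).
  rewrite !win_probE nwins_ext natrD !natrM !natrX -exprMn -natrM !exprS.
  rewrite le_eqVlt; apply/orP; left; apply/eqP; field.
  by rewrite expf_neq0 // pnatr_eq0.
(* The maximum defining [V2] is taken together with 0, so the bound must also be
   checked at 0; any particular strategy gives that. *)
suff : V2 R n.+1 <= 16 * (V2 R n.+3 - 21 / 64) by lra.
apply/bigmax_leP; split => [|k _]; last by have := ext_le k.1 k.2; lra.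
pose k0 : strategy n.+1 := [ffun=> ord0].
have p_ge0 : 0 <= win_prob R k0 k0 by rewrite divr_ge0.
have := ext_le k0 k0; lra.
Qed.

(** The constant 28/5 is 16 * 7/20: it makes the bound vanish at 2 hats and
    negative at 1 hat, the two base cases of a recursion with step 2. *)
Lemma V2_lower (R : realType) n :
  7 / 20 - 28 / 5 / 4 ^+ n.+1 <= V2 R n.+1.
Proof.
have V2_ge0 h : 0 <= V2 R h by apply: bigmax_ge_id.
suff : 7 / 20 - 28 / 5 / 4 ^+ n.+1 <= V2 R n.+1 /\
       7 / 20 - 28 / 5 / 4 ^+ n.+2 <= V2 R n.+2 by case.
elim: n => [|n [IH1 IH2]].
  by split; [have := V2_ge0 1 | have := V2_ge0 2]; rewrite !exprS expr0; lra.
split=> //; apply: le_trans (V2_rec R n).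
have -> : 28 / 5 / 4 ^+ n.+3 = 28 / 5 / 4 ^+ n.+1 / 16 :> R.
  by rewrite !exprS; field; rewrite expf_neq0 // pnatr_eq0.
lra.
Qed.

Lemma root5_256_le4 (R : realType) : 256 `^ (1 / 5) <= 4 :> R.
Proof.
have -> : 4 = 1024 `^ (1 / 5) :> R.
  have -> : 1024 = 4 `^ 5 :> R by rewrite powR_mulrn // !exprS expr0; ring.
  by rewrite -powRrM (_ : 5 * (1 / 5) = 1) ?powRr1 //; field.
by apply: ge0_ler_powR; rewrite ?nnegrE; lra.
Qed.

Theorem theorem18 (R : realType) :
  exists C : R, 0 < C /\
    forall h : nat, (1 <= h)%N ->
      7 / 20 - C / (256 `^ (1 / 5)) ^+ h <= V2 R h.
Proof.
exists (28 / 5); split; first by lra.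
case=> // n _; apply: le_trans (V2_lower R n).
have x_gt0 : 0 < 256 `^ (1 / 5) :> R by apply: powR_gt0; lra.
rewrite lerD2l lerN2 ler_pM2l; last by lra.
rewrite lef_pV2 ?posrE ?exprn_gt0 //.
by rewrite lerXn2r ?nnegrE ?(ltW x_gt0) // root5_256_le4.
Qed.
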